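(* The binary relation $\unlhd_{\mathrm{st}}$ is a partial order on $\mathcal{M}_1(\mathbb{M}_{\mathrm{GHP}})$, and it obeys the following sandwich theorem: for all sequences $(\mathbb{P}^-_n)_{n\geq1}$, $(\mathbb{P}_n)_{n\geq1}$, $(\mathbb{P}^+_n)_{n\geq1}$ of elements of $\mathcal{M}_1(\mathbb{M}_{\mathrm{GHP}})$ and every $\mathbb{P}_\infty\in\mathcal{M}_1(\mathbb{M}_{\mathrm{GHP}})$, if $\mathbb{P}^-_n\unlhd_{\mathrm{st}}\mathbb{P}_n\unlhd_{\mathrm{st}}\mathbb{P}^+_n$ for every $n$, and $\mathbb{P}^-_n\to\mathbb{P}_\infty$ and $\mathbb{P}^+_n\to\mathbb{P}_\infty$ weakly (with respect to the GHP topology), then $\mathbb{P}_n\to\mathbb{P}_\infty$ weakly.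
   Context: $\mathbb{M}_{\mathrm{GHP}}$ is the set of measure-preserving isometry classes of compact metric measure spaces $(X,d,\mu)$ ($(X,d)$ compact metric, $\mu$ finite Borel measure), equipped with the Gromov--Hausdorff--Prokhorov (GHP) metric: the infimum over metric spaces $(Z,\delta)$ and isometric embeddings $\phi,\phi'$ of $X,X'$ into $Z$ of the Hausdorff distance between $\phi(X),\phi'(X')$ plus the Prokhorov distance between $\phi_*\mu,\phi'_*\mu'$. $\mathcal{M}_1(\mathbb{M}_{\mathrm{GHP}})$ is the set of Borel probability measures on $\mathbb{M}_{\mathrm{GHP}}$ with the topology of weak convergence. For $\mathcal{X}=[X,d,\mu]$, $\mathcal{X}'=[X',d',\mu']$, write $\mathcal{X}\unlhd\mathcal{X}'$ if there is a surjective map $\phi:X'\to X$ that is 1-Lipschitz and measure-contracting ($\mu(A)\le\mu'(\phi^{-1}(A))$ for all Borel $A\subset X$). A Borel set $A\subset\mathbb{M}_{\mathrm{GHP}}$ is $\unlhd$-increasing if $\mathcal{X}\in A$ and $\mathcal{X}\unlhd\mathcal{X}'$ imply $\mathcal{X}'\in A$. For $\mathbb{P},\mathbb{P}'\in\mathcal{M}_1(\mathbb{M}_{\mathrm{GHP}})$, $\mathbb{P}\unlhd_{\mathrm{st}}\mathbb{P}'$ means $\mathbb{P}(A)\le\mathbb{P}'(A)$ for every $\unlhd$-increasing Borel set $A$. *)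

(* Defs.v *)
From HB Require Import structures.
From mathcomp Require Import all_boot all_order all_algebra.
From mathcomp Require Import all_classical all_reals all_analysis.
From mathcomp Require Import Rstruct.
Set Implicit Arguments. Unset Strict Implicit. Unset Printing Implicit Defensive.
Import Order.TTheory GRing.Theory Num.Theory.
Local Open Scope classical_set_scope.
Local Open Scope ring_scope.

Notation RR := Rdefinitions.R.

Definition is_metric {T : Type} (d : T -> T -> RR) : Prop :=
  (forall x y, 0 <= d x y) /\ (forall x y, d x y = 0 <-> x = y) /\
  (forall x y, d x y = d y x) /\ (forall x y z, d x z <= d x y + d y z).

Definition dopen {T : Type} (d : T -> T -> RR) : set (set T) :=
  [set U | forall x, U x -> exists e : RR, 0 < e /\ forall y, d x y < e -> U y].

Definition dborel {T : Type} (d : T -> T -> RR) : set (set T) := <<s dopen d >>.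

Definition dcompact {T : Type} (d : T -> T -> RR) : Prop :=
  forall (I : Type) (U : I -> set T), (forall i, dopen d (U i)) ->
    setT `<=` \bigcup_i U i ->
    exists F : seq I, forall x : T, exists2 i, List.In i F & U i x.

Definition borel_of {T : Type} (x0 : T) (d : T -> T -> RR) : Type := T.
Section borel_of_instance.
Variables (T : Type) (x0 : T) (d : T -> T -> RR).
HB.instance Definition _ := gen_eqMixin (borel_of x0 d).
HB.instance Definition _ := gen_choiceMixin (borel_of x0 d).
HB.instance Definition _ := isPointed.Build (borel_of x0 d) x0.
End borel_of_instance.
Definition borelT {T : Type} (x0 : T) (d : T -> T -> RR) :=
  g_sigma_algebraType (dopen d : set (set (borel_of x0 d))).

Record mmspace : Type := MMSpace {
  mm_car : Type;
  mm_pt : mm_car;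
  mm_d : mm_car -> mm_car -> RR;
  mm_metric : is_metric mm_d;
  mm_compact : dcompact mm_d;
  mm_mu : {finite_measure set (borelT mm_pt mm_d) -> \bar RR} }.

Definition isometry {X Y : Type} (dX : X -> X -> RR) (dY : Y -> Y -> RR)
  (f : X -> Y) : Prop := forall x y, dY (f x) (f y) = dX x y.

Definition nbhd {Z : Type} (dZ : Z -> Z -> RR) (e : RR) (A : set Z) : set Z :=
  [set z | exists2 a, A a & dZ z a < e].

Definition hausdorff_dist {Z : Type} (dZ : Z -> Z -> RR) (A B : set Z) : RR :=
  inf [set e : RR | 0 < e /\ A `<=` nbhd dZ e B /\ B `<=` nbhd dZ e A].

Definition prokhorov_push {Z : Type} (dZ : Z -> Z -> RR) {X Y : Type}
  (mu : set X -> \bar RR) (nu : set Y -> \bar RR) (phi : X -> Z) (psi : Y -> Z)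
  : RR :=
  inf [set e : RR | 0 < e /\ forall A : set Z, dborel dZ A ->
        (mu (phi @^-1` A) <= nu (psi @^-1` nbhd dZ e A) + e%:E)%E /\
        (nu (psi @^-1` A) <= mu (phi @^-1` nbhd dZ e A) + e%:E)%E].

Definition dGHP (X Y : mmspace) : RR :=
  inf [set r : RR | exists (Z : Type) (dZ : Z -> Z -> RR)
      (phi : mm_car X -> Z) (psi : mm_car Y -> Z),
      [/\ is_metric dZ, isometry (@mm_d X) dZ phi, isometry (@mm_d Y) dZ psi &
          r = hausdorff_dist dZ (range phi) (range psi) +
              prokhorov_push dZ (mm_mu X) (mm_mu Y) phi psi]].

Definition unit_d (x y : unit) : RR := 0.
Lemma unit_d_metric : is_metric unit_d.
Proof.
rewrite /unit_d; split; first by [].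
split; first by move=> [] []; split.
by split=> // *; rewrite addr0.
Qed.
Lemma unit_d_compact : dcompact unit_d.
Proof.
move=> I U _ cov; have [i _ Ui] := cov tt Logic.I.
by exists [:: i] => -[]; exists i => //=; left.
Qed.
Definition unit_mm : mmspace :=
  @MMSpace unit tt unit_d unit_d_metric unit_d_compact
    (\d_ (tt : borelT tt unit_d)).

HB.instance Definition _ := gen_eqMixin mmspace.
HB.instance Definition _ := gen_choiceMixin mmspace.
HB.instance Definition _ := isPointed.Build mmspace unit_mm.

Definition GHPopen : set (set mmspace) := dopen dGHP.
Definition MGHP := g_sigma_algebraType GHPopen.

Definition mm_le (X X' : mmspace) : Prop :=
  exists phi : mm_car X' -> mm_car X,
    [/\ (forall x, exists x', phi x' = x),
        (forall x y, mm_d (phi x) (phi y) <= mm_d x y) &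
        (forall A : set (mm_car X), dborel (@mm_d X) A ->
           (mm_mu X A <= mm_mu X' (phi @^-1` A))%E)].

Definition le_increasing (A : set MGHP) : Prop :=
  measurable A /\ forall X X' : mmspace, A X -> mm_le X X' -> A X'.

Definition stoch_le (P P' : probability MGHP RR) : Prop :=
  forall A : set MGHP, le_increasing A -> (P A <= P' A)%E.

Definition ghp_continuous (f : MGHP -> RR) : Prop :=
  forall (x : MGHP) (e : RR), 0 < e -> exists2 dl : RR, 0 < dl &
    forall y : MGHP, dGHP x y < dl -> `|f x - f y| < e.

Definition weak_cvg (P : nat -> probability MGHP RR) (Q : probability MGHP RR)
  : Prop :=
  forall f : MGHP -> RR, (exists C : RR, forall x, `|f x| <= C) ->
    ghp_continuous f ->
    (fun n => (\int[P n]_x (f x)%:E)%E) @ \oo --> (\int[Q]_x (f x)%:E)%E.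

(* Main.v *)
(* Idea. Say that [X] is [e]-dominated by [Y] when there is a multivalued map from
   [X] to [Y] that is expanding up to [e] and loses at most [e] of the mass of any
   open set. The least such [e] is an asymmetric distance, [gap X Y]: it satisfies
   the triangle inequality, is at most a multiple of the GHP distance, and vanishes
   when [mm_le X Y]; hence [gap X Y] is continuous and increasing in [X], decreasing
   in [Y]. A recurrence argument on orbits in a compact space shows that if [gap X Y]
   and [gap Y X] are both small then [X] and [Y] are GHP-close, so increasing
   functions of the form [gap ^~ X] and [- gap X] generate the GHP topology, which is
   moreover Lindelof. Increasing sets form a pi-system, which gives antisymmetry. The
   convergence of the means is inherited by the sandwiched sequence for bounded
   continuous increasing functions, hence for the algebra they span, and a partition
   of unity taken in this algebra approximates any bounded continuous function up to
   a function of small mean. *)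

Require Import Defs.
From HB Require Import structures.
From mathcomp Require Import all_boot all_order all_algebra.
From mathcomp Require Import all_classical all_reals all_analysis.
From mathcomp Require Import measurable_realfun Rstruct.
From mathcomp Require Import ring lra.
Set Implicit Arguments.
Unset Strict Implicit.
Unset Printing Implicit Defensive.
Import Order.TTheory GRing.Theory Num.Theory.
Import numFieldNormedType.Exports.
Local Open Scope classical_set_scope.
Local Open Scope ring_scope.

(** * Compact metric spaces *)

Section metric.
Context {T : Type} (d : T -> T -> RR) (dM : is_metric d).

Lemma metric_ge0 x y : 0 <= d x y. Proof. by case: dM. Qed.
Lemma metric_xx x : d x x = 0. Proof. by have [_ [/(_ x x)[_ ->]]] := dM. Qed.
Lemma metric_sym x y : d x y = d y x. Proof. by have [_ [_ []]] := dM. Qed.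
Lemma metric_tri y x z : d x z <= d x y + d y z.
Proof. by have [_ [_ []]] := dM. Qed.
Lemma metric_eq0 x y : d x y = 0 -> x = y.
Proof. by have [_ [/(_ x y)[+ _]]] := dM. Qed.

Lemma dopen_ball x e : dopen d [set y | d x y < e].
Proof.
move=> y /= xy; exists (e - d x y); split=> [|z yz]; first lra.
by have := metric_tri y x z; lra.
Qed.

Lemma dopen_nbhd e A : dopen d (nbhd d e A).
Proof.
move=> y [a Aa ya]; exists (e - d y a); split=> [|z yz]; first lra.
by exists a => //; have := metric_tri y z a; rewrite (metric_sym z y); lra.
Qed.

Lemma dopen_bigcup I (F : I -> set T) (D : set I) :
  (forall i, D i -> dopen d (F i)) -> dopen d (\bigcup_(i in D) F i).
Proof.
move=> oF x [i Di /(oF i Di)[e [e0 xe]]].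
by exists e; split=> // y /xe Fy; exists i.
Qed.

Hypothesis dC : dcompact d.

Lemma dcompact_net e : 0 < e ->
  exists (n : nat) (p : 'I_n -> T), forall x, exists i, d (p i) x < e.
Proof.
move=> e0.
have [|s sP] := dC (fun x => @dopen_ball x e).
  by move=> x _; exists x => //=; rewrite metric_xx.
exists (size s), (fun i => tnth (in_tuple s) i) => x.
have [i si ix] := sP x.
suff [j E] : exists j, i = tnth (in_tuple s) j by exists j; rewrite -E.
elim: s si {sP} => //= a s IH [<-|/IH[j ->]]; first by exists ord0.
exists (lift ord0 j); by rewrite !(tnth_nth a).
Qed.

Lemma dcompact_bounded : exists2 M, 0 < M & forall x y, d x y <= M.
Proof.
have [n [p pP]] := dcompact_net ltr01.
exists (2 + \sum_(i < n) \sum_(j < n) d (p i) (p j)) => [|x y].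
  rewrite ltr_wpDr// sumr_ge0// => i _; rewrite sumr_ge0// => j _.
  exact: metric_ge0.
have [[i xi] [j yj]] := (pP x, pP y).
have : d (p i) (p j) <= \sum_(i < n) \sum_(j < n) d (p i) (p j).
  rewrite (bigD1 i)//= (bigD1 j)//= -addrA lerDl addr_ge0//.
    by rewrite sumr_ge0// => *; exact: metric_ge0.
  by rewrite sumr_ge0// => *; rewrite sumr_ge0// => *; exact: metric_ge0.
have := metric_tri (p i) x y; have := metric_tri (p j) (p i) y.
by rewrite (metric_sym x (p i)); lra.
Qed.

(** Pigeonhole: label each time by the pair of net points near [u] and [v]. Among one more time than
    there are pairs, two carry the same label. *)
Lemma dcompact_recurrence e : 0 < e -> exists N : nat, forall u v : nat -> T,
  exists k l, [/\ (k < l)%N, (l <= N)%N, d (u k) (u l) < e & d (v k) (v l) < e].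
Proof.
move=> e0; have e20 : 0 < e / 2 by lra.
have [n [p pP]] := dcompact_net e20.
exists #|{: 'I_n * 'I_n}| => u v.
have [c cP] := choice pP.
pose g (k : 'I_(#|{: 'I_n * 'I_n}|.+1)) := (c (u k), c (v k)).
have /injectivePn[k [l kl gkl]] : ~~ injectiveb g.
  by apply/negP => /injectiveP/leq_card; rewrite card_ord ltnn.
wlog lt_kl : k l kl gkl / (k < l)%N.
  move=> W; have [|lk|/val_inj E] := ltngtP k l; first exact: W.
    by apply: (W l k) => //; rewrite eq_sym.
  by rewrite E eqxx in kl.
exists k, l; split=> //; first by rewrite -ltnS.
- case: gkl => E _; have := cP (u k); have := cP (u l); rewrite -E.
  have := metric_tri (p (c (u k))) (u k) (u l).
  by rewrite (metric_sym (u k) (p _)); lra.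
- case: gkl => _ E; have := cP (v k); have := cP (v l); rewrite -E.
  have := metric_tri (p (c (v k))) (v k) (v l).
  by rewrite (metric_sym (v k) (p _)); lra.
Qed.

(** Advancing both orbits by one step shrinks their distance by at most [eta]. *)
Lemma orbit_shift (S : T -> T -> Prop) eta (u v : nat -> T) :
  (forall x x' z z', S x z -> S x' z' -> d x x' <= d z z' + eta) ->
  (forall k, S (u k) (u k.+1)) -> (forall k, S (v k) (v k.+1)) ->
  forall k i j, d (u i) (v j) <= d (u (k + i)%N) (v (k + j)%N) + k%:R * eta.
Proof.
move=> SP uS vS; elim=> [|k IH] i j; first by rewrite mul0r addr0.
have := IH i j; have := SP _ _ _ _ (uS (k + i)%N) (vS (k + j)%N).
by rewrite -!addSn -natr1; lra.
Qed.

(* An approximately expanding relation of a compact space to itself is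
   approximately isometric and onto, because orbits are recurrent. *)
Lemma expanding_self e : 0 < e -> exists2 eta, 0 < eta &
  forall S : T -> T -> Prop, (forall x, exists z, S x z) ->
  (forall x x' z z', S x z -> S x' z' -> d x x' <= d z z' + eta) ->
  (forall x x' z z', S x z -> S x' z' -> d z z' <= d x x' + e) /\
  (forall a, exists b c, S b c /\ d a c <= e).
Proof.
move=> e0; have e40 : 0 < e / 4 by lra.
have [N NP] := dcompact_recurrence e40.
have N0 : 0 < N%:R + 1 :> RR by have : 0 <= N%:R :> RR by []; lra.
(* A shift by at most [N] steps then costs at most [e / 6]. The distortion bound uses two returns at
   [e / 4 + e / 6] each and one further shift, which add up to [e]. *)
exists (e / (6 * (N%:R + 1))) => [|S S1 SP].
  by rewrite divr_gt0// mulr_gt0.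
set eta := e / _ in SP; have etaP k : (k <= N)%N -> k%:R * eta <= e / 6.
  move=> kN; have -> : e / 6 = (N%:R + 1) * eta by rewrite /eta; field; lra.
  rewrite ler_wpM2r//; first by rewrite /eta divr_ge0//; lra.
  by rewrite natr1 ler_nat leqW.
have [s sP] := choice S1.
(* The first step is the prescribed [z], which need not be the successor chosen by [s]. *)
pose orb x z k := if k is k'.+1 then iter k' s z else x.
have orbS x z : S x z -> forall k, S (orb x z k) (orb x z k.+1).
  by move=> xz [|k]//=; exact: sP.
(* A recurrence between times [k] and [l], shifted back by [k], becomes a return to the starting
   point at time [l - k], the same for both orbits. *)
have orbR x x' z z' : S x z -> S x' z' -> exists m, [/\ (m.+1 <= N)%N,
    d x (orb x z m.+1) <= e / 4 + e / 6 & d x' (orb x' z' m.+1) <= e / 4 + e / 6].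
  move=> xz xz'; have [k [l [kl lN uk vk]]] := NP (orb x z) (orb x' z').
  have kN : (k <= N)%N by rewrite (leq_trans (ltnW kl)).
  exists (l - k).-1; rewrite prednK ?subn_gt0//; split.
  - by rewrite (leq_trans _ lN)// leq_subr.
  - have := orbit_shift SP (orbS _ _ xz) (orbS _ _ xz) k 0%N (l - k)%N.
    by rewrite addn0 subnKC 1?ltnW//; have := etaP k kN; lra.
  - have := orbit_shift SP (orbS _ _ xz') (orbS _ _ xz') k 0%N (l - k)%N.
    by rewrite addn0 subnKC 1?ltnW//; have := etaP k kN; lra.
split=> [x x' z z' xz xz'|a].
  (* At the common return time the orbits are about as far apart as [x] and [x']; shifting back by
     [m] bounds their distance at time one. *)
  have [m [mN um vm]] := orbR _ _ _ _ xz xz'.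
  have := orbit_shift SP (orbS _ _ xz) (orbS _ _ xz') m 1%N 1%N.
  rewrite addn1; have := etaP m (ltnW mN).
  have := metric_tri x (orb x z m.+1) (orb x' z' m.+1).
  have := metric_tri x' x (orb x' z' m.+1).
  by rewrite (metric_sym _ x) [orb _ _ 1]/= [orb _ _ 1]/=; lra.
(* The returning point of the orbit of [a] is the image of the point just before it. *)
have [z az] := S1 a; have [m [mN um _]] := orbR _ _ _ _ az az.
by exists (orb a z m), (orb a z m.+1); split; [exact: orbS|lra].
Qed.

End metric.

(** * Gluing two metric spaces along an approximate isometry *)

Section glue.
Context {X Y : Type} (dX : X -> X -> RR) (dY : Y -> Y -> RR).
Hypotheses (mX : is_metric dX) (mY : is_metric dY).
Variables (R : X -> Y -> Prop) (e : RR).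
Hypotheses (e0 : 0 < e) (R0 : exists x y, R x y).
Hypothesis RXY : forall x x' y y', R x y -> R x' y' -> dX x x' <= dY y y' + 2 * e.
Hypothesis RYX : forall x x' y y', R x y -> R x' y' -> dY y y' <= dX x x' + 2 * e.

(** Length of the shortest path from [x] to [y] that crosses once, at a related pair, at cost
    [e]. *)
Definition cross_dist (x : X) (y : Y) : RR :=
  inf [set r | exists x1 y1, R x1 y1 /\ r = dX x x1 + dY y1 y + e].

Lemma cross_dist_lbound x y :
  lbound [set r | exists x1 y1, R x1 y1 /\ r = dX x x1 + dY y1 y + e] e.
Proof.
by move=> _ [x1 [y1 [_ ->]]]; have := metric_ge0 mX x x1;
  have := metric_ge0 mY y1 y; lra.
Qed.

Lemma cross_dist_nonempty x y :
  [set r | exists x1 y1, R x1 y1 /\ r = dX x x1 + dY y1 y + e] !=set0.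
Proof.
by have [x1 [y1 xy]] := R0; exists (dX x x1 + dY y1 y + e), x1, y1.
Qed.

Lemma cross_dist_ge x y : e <= cross_dist x y.
Proof.
exact: lb_le_inf (cross_dist_nonempty x y) (@cross_dist_lbound x y).
Qed.

Lemma cross_dist_le x y x1 y1 : R x1 y1 ->
  cross_dist x y <= dX x x1 + dY y1 y + e.
Proof.
move=> xy1; apply: ge_inf; last by exists x1, y1.
by exists e; exact: cross_dist_lbound.
Qed.

Lemma cross_dist_approx x y t : 0 < t ->
  exists x1 y1, R x1 y1 /\ dX x x1 + dY y1 y + e < cross_dist x y + t.
Proof.
move=> t0; have hinf := conj (cross_dist_nonempty x y)
  (ex_intro _ e (@cross_dist_lbound x y)).
have [_ [x1 [y1 [xy1 ->]]] lt] := inf_adherent t0 hinf.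
by exists x1, y1.
Qed.

Definition glue_dist (p q : X + Y) : RR :=
  match p, q with
  | inl x, inl x' => dX x x'
  | inr y, inr y' => dY y y'
  | inl x, inr y => cross_dist x y
  | inr y, inl x => cross_dist x y
  end.

(** A path that crosses over and back pays [2 * e], exactly the distortion allowed to [R], so it is
    no shortcut. Positivity of [e] keeps the two copies apart. *)
Lemma glue_dist_metric : is_metric glue_dist.
Proof.
have pos x y := lt_le_trans e0 (cross_dist_ge x y).
have LX x x' y : cross_dist x y <= dX x x' + cross_dist x' y.
  apply/ler_addgt0Pr => t t0; have [x1 [y1 [xy1 lt]]] := cross_dist_approx x' y t0.
  by have := cross_dist_le x y xy1; have := metric_tri mX x' x x1; lra.
have LY x y y' : cross_dist x y <= cross_dist x y' + dY y' y.
  apply/ler_addgt0Pr => t t0; have [x1 [y1 [xy1 lt]]] := cross_dist_approx x y' t0.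
  by have := cross_dist_le x y xy1; have := metric_tri mY y' y1 y; lra.
have LXX x x' y : dX x x' <= cross_dist x y + cross_dist x' y.
  apply/ler_addgt0Pr => t t0; have t20 : 0 < t / 2 by lra.
  have [x1 [y1 [xy1 lt1]]] := cross_dist_approx x y t20.
  have [x2 [y2 [xy2 lt2]]] := cross_dist_approx x' y t20.
  have := RXY xy1 xy2; have := metric_tri mY y y1 y2.
  have := metric_tri mX x1 x x'; have := metric_tri mX x2 x1 x'.
  by rewrite (metric_sym mX x2 x') (metric_sym mY y y2); lra.
have LYY x y y' : dY y y' <= cross_dist x y + cross_dist x y'.
  apply/ler_addgt0Pr => t t0; have t20 : 0 < t / 2 by lra.
  have [x1 [y1 [xy1 lt1]]] := cross_dist_approx x y t20.
  have [x2 [y2 [xy2 lt2]]] := cross_dist_approx x y' t20.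
  have := RYX xy1 xy2; have := metric_tri mX x x1 x2.
  have := metric_tri mY y1 y y'; have := metric_tri mY y2 y1 y'.
  by rewrite (metric_sym mX x1 x) (metric_sym mY y y1); lra.
split; [|split; [|split]].
- by move=> [x|y] [x'|y'] /=; rewrite ?metric_ge0// ltW.
- move=> [x|y] [x'|y'] /=; split.
  + by move/(metric_eq0 mX) ->.
  + by case=> ->; rewrite metric_xx.
  + by have := pos x y' => /[swap] ->; rewrite ltxx.
  + by [].
  + by have := pos x' y => /[swap] ->; rewrite ltxx.
  + by [].
  + by move/(metric_eq0 mY) ->.
  + by case=> ->; rewrite metric_xx.
- by move=> [x|y] [x'|y'] //=; rewrite metric_sym.
- move=> [x|y] [x'|y'] [x''|y''] //=.
  + exact: metric_tri.
  + by rewrite addrC (metric_sym mX x') addrC addrC; exact: LX.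
  + by rewrite addrC (metric_sym mY y); exact: LY.
  + exact: metric_tri.
Qed.

End glue.

(** * Approximate domination of metric measure spaces *)

Lemma inf_pos_ge0 (S : set RR) : (forall x, S x -> 0 < x) -> 0 <= inf S.
Proof.
(* The infimum of the empty set is [0] by convention. *)
move=> S0; have [->|/set0P Sn0] := eqVneq S set0; first by rewrite inf0.
by apply: lb_le_inf => // x /S0/ltW.
Qed.

Lemma dborel_dopen T (d : T -> T -> RR) (U : set T) : dopen d U -> dborel d U.
Proof. exact: sub_sigma_algebra. Qed.

Lemma dborelC T (d : T -> T -> RR) (A : set T) : dborel d A -> dborel d (~` A).
Proof. by rewrite -setTD; case: (smallest_sigma_algebra setT (dopen d)) => _ + _; exact. Qed.

Lemma dborel_preimage S T (dS : S -> S -> RR) (dT : T -> T -> RR) (f : S -> T) :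
  (forall U, dopen dT U -> dopen dS (f @^-1` U)) ->
  forall A, dborel dT A -> dborel dS (f @^-1` A).
Proof.
move=> fc; have [B0 BC BU] := smallest_sigma_algebra setT (dopen dS).
apply: smallest_sub => [|U /fc]; last exact: dborel_dopen.
split=> [|A|F FB]; first by rewrite /= preimage_set0.
  by rewrite setTD /= preimage_setC; exact: dborelC.
by rewrite /= preimage_bigcup; exact: BU.
Qed.

Lemma dborel_preimage_lipschitz S T (dS : S -> S -> RR) (dT : T -> T -> RR)
    (f : S -> T) : (forall x y, dT (f x) (f y) <= dS x y) ->
  forall A, dborel dT A -> dborel dS (f @^-1` A).
Proof.
move=> fL; apply: dborel_preimage => U oU x /oU[e [e0 eU]].
by exists e; split=> // y xy; apply: eU; exact: le_lt_trans (fL _ _) xy.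
Qed.

Definition mass (X : mmspace) (A : set (mm_car X)) : RR := fine (mm_mu X A).
Arguments mass : clear implicits.

Section mass.
Variable X : mmspace.
Notation borel := (dborel (@mm_d X)).

Lemma massE A : borel A -> mm_mu X A = (mass X A)%:E.
Proof. by move=> mA; rewrite fineK// fin_num_measure. Qed.

Lemma mass_ge0 A : 0 <= mass X A.
Proof. by rewrite /mass fine_ge0. Qed.

Lemma le_mass A B : borel A -> borel B -> A `<=` B -> mass X A <= mass X B.
Proof.
by move=> mA mB AB; rewrite -lee_fin -!massE// le_measure// inE.
Qed.

Lemma dborelU A B : borel A -> borel B -> borel (A `|` B).
Proof. exact: (@measurableU _ (borelT (mm_pt X) (@mm_d X))). Qed.

Lemma massU A B : borel A -> borel B -> A `&` B = set0 ->
  mass X (A `|` B) = mass X A + mass X B.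
Proof.
move=> mA mB AB; apply: EFin_inj; rewrite EFinD -!massE//; first exact: measureU.
exact: dborelU.
Qed.

Lemma dborelT : borel setT.
Proof. by apply: dborel_dopen => x _; exists 1. Qed.

Lemma massC A : borel A -> mass X setT = mass X A + mass X (~` A).
Proof. by move=> mA; rewrite -massU ?setICr ?setUv//; exact: dborelC. Qed.

End mass.
Arguments mass_ge0 : clear implicits.
Arguments dborelT : clear implicits.

Lemma isometry_borel X Z (dX : X -> X -> RR) (dZ : Z -> Z -> RR) phi A :
  Defs.isometry dX dZ phi -> dborel dZ A -> dborel dX (phi @^-1` A).
Proof. by move=> h; apply: dborel_preimage_lipschitz => x y; rewrite h. Qed.

Lemma dGHP_le (X Y : mmspace) (Z : Type) (dZ : Z -> Z -> RR)
    (phi : mm_car X -> Z) (psi : mm_car Y -> Z) (e1 e2 : RR) :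
  is_metric dZ -> Defs.isometry (@mm_d X) dZ phi -> Defs.isometry (@mm_d Y) dZ psi ->
  0 < e1 -> 0 < e2 ->
  (forall x, exists y, dZ (phi x) (psi y) < e1) ->
  (forall y, exists x, dZ (psi y) (phi x) < e1) ->
  (forall A, dborel dZ A ->
    mass X (phi @^-1` A) <= mass Y (psi @^-1` nbhd dZ e2 A) + e2 /\
    mass Y (psi @^-1` A) <= mass X (phi @^-1` nbhd dZ e2 A) + e2) ->
  dGHP X Y <= e1 + e2.
Proof.
move=> mZ iphi ipsi e10 e20 h1 h2 hA.
apply: (@le_trans _ _ (hausdorff_dist dZ (range phi) (range psi) +
                  prokhorov_push dZ (mm_mu X) (mm_mu Y) phi psi)).
  apply: ge_inf; last by exists Z, dZ, phi, psi.
  exists 0 => _ [Z' [dZ' [phi' [psi' [_ _ _ ->]]]]].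
  by apply: addr_ge0; apply: inf_pos_ge0 => x [].
apply: lerD; apply: ge_inf; do ?by exists 0 => x [/ltW].
  split=> //; split=> _ [x _ <-].
    by have [y ?] := h1 x; exists (psi y) => //; exists y.
  by have [y ?] := h2 x; exists (phi y) => //; exists y.
split=> // A mA; have mN : dborel dZ (nbhd dZ e2 A).
  by apply: dborel_dopen; exact: dopen_nbhd.
rewrite !massE; do ?exact: isometry_borel ipsi _; do ?exact: isometry_borel iphi _.
by rewrite -!EFinD !lee_fin; exact: hA.
Qed.

(** Needed because [inf] takes a default value on the empty set. The two spaces are glued along the
    full relation, at a crossing cost that exceeds both diameters. *)
Lemma dGHP_defined (X Y : mmspace) : exists r (Z : Type) (dZ : Z -> Z -> RR)
      (phi : mm_car X -> Z) (psi : mm_car Y -> Z),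
      [/\ is_metric dZ, Defs.isometry (@mm_d X) dZ phi, Defs.isometry (@mm_d Y) dZ psi &
          r = hausdorff_dist dZ (range phi) (range psi) +
              prokhorov_push dZ (mm_mu X) (mm_mu Y) phi psi].
Proof.
have [mX mY] := (mm_metric X, mm_metric Y).
have [M M0 MP] := dcompact_bounded mX (@mm_compact X).
have [N N0 NP] := dcompact_bounded mY (@mm_compact Y).
have MN0 : 0 < M + N by lra.
have R0 : exists (x : mm_car X) (y : mm_car Y), True by exists (mm_pt X), (mm_pt Y).
do 5 eexists; split; last reflexivity.
- apply: (glue_dist_metric mX mY MN0 R0).
  + by move=> x x' y y' _ _; have := MP x x'; have := metric_ge0 mY y y'; lra.
  + by move=> x x' y y' _ _; have := NP y y'; have := metric_ge0 mX x x'; lra.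
- by move=> x x'; instantiate (1 := inl).
- by move=> x x'; instantiate (1 := inr).
Qed.

Lemma dGHP_lt (X Y : mmspace) (t : RR) : dGHP X Y < t ->
  exists (Z : Type) (dZ : Z -> Z -> RR) (phi : mm_car X -> Z)
    (psi : mm_car Y -> Z) (e : RR),
  [/\ is_metric dZ, Defs.isometry (@mm_d X) dZ phi, Defs.isometry (@mm_d Y) dZ psi, 0 < e < t &
   [/\ forall x, exists y, dZ (phi x) (psi y) < t,
       forall y, exists x, dZ (psi y) (phi x) < t &
   forall A, dborel dZ A ->
    mass X (phi @^-1` A) <= mass Y (psi @^-1` nbhd dZ e A) + e /\
    mass Y (psi @^-1` A) <= mass X (phi @^-1` nbhd dZ e A) + e]].
Proof.
rewrite -subr_gt0 => t0.
have [|r [Z [dZ [phi [psi [mZ iphi ipsi rE]]]]]] := inf_adherent t0 (E := [set r : RR |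
      exists (Z : Type) (dZ : Z -> Z -> RR)
      (phi : mm_car X -> Z) (psi : mm_car Y -> Z),
      [/\ is_metric dZ, Defs.isometry (@mm_d X) dZ phi, Defs.isometry (@mm_d Y) dZ psi &
          r = hausdorff_dist dZ (range phi) (range psi) +
              prokhorov_push dZ (mm_mu X) (mm_mu Y) phi psi]]).
  split; first exact: dGHP_defined.
  exists 0 => _ [Z' [dZ' [phi' [psi' [_ _ _ ->]]]]].
  by apply: addr_ge0; apply: inf_pos_ge0 => x [].
rewrite -/(dGHP X Y) addrC subrK => rt.
set S1 := [set e : RR | 0 < e /\ range phi `<=` nbhd dZ e (range psi) /\
                       range psi `<=` nbhd dZ e (range phi)].
set S2 := [set e : RR | 0 < e /\ forall A : set Z, dborel dZ A ->
        (mm_mu X (phi @^-1` A) <= mm_mu Y (psi @^-1` nbhd dZ e A) + e%:E)%E /\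
        (mm_mu Y (psi @^-1` A) <= mm_mu X (phi @^-1` nbhd dZ e A) + e%:E)%E].
have r0 : r = inf S1 + inf S2 by [].
have S10 : 0 <= inf S1 by apply: inf_pos_ge0 => x [].
have S20 : 0 <= inf S2 by apply: inf_pos_ge0 => x [].
have mN e A : dborel dZ (nbhd dZ e A).
  by apply: dborel_dopen; exact: dopen_nbhd.
have massP e A : dborel dZ A ->
    (mm_mu X (phi @^-1` A) <= mm_mu Y (psi @^-1` nbhd dZ e A) + e%:E)%E /\
        (mm_mu Y (psi @^-1` A) <= mm_mu X (phi @^-1` nbhd dZ e A) + e%:E)%E <->
    mass X (phi @^-1` A) <= mass Y (psi @^-1` nbhd dZ e A) + e /\
    mass Y (psi @^-1` A) <= mass X (phi @^-1` nbhd dZ e A) + e.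
  move=> mA; rewrite !massE ?lee_fin//; do ?exact: isometry_borel ipsi _.
    exact: isometry_borel iphi _.
  exact: isometry_borel iphi _.
(* Both infima are nonnegative, so each is at most [r], and a slack of [t - r] keeps both witnesses
   below [t]. *)
have rt0 : 0 < t - r by lra.
have [|e1 [e10 [h1 h2]] e1r] := inf_adherent rt0 (E := S1).
  split; last by exists 0 => x [/ltW].
  have [M M0 MP] := dcompact_bounded (mm_metric X) (@mm_compact X).
  have [N N0 NP] := dcompact_bounded (mm_metric Y) (@mm_compact Y).
  pose c := dZ (phi (mm_pt X)) (psi (mm_pt Y)).
  have c0 := metric_ge0 mZ (phi (mm_pt X)) (psi (mm_pt Y)).
  exists (M + N + c + 1); split; first by rewrite /c; lra.
  split=> _ [x _ <-].
    exists (psi (mm_pt Y)); first by exists (mm_pt Y).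
    have := metric_tri mZ (phi (mm_pt X)) (phi x) (psi (mm_pt Y)).
    by rewrite iphi; have := MP x (mm_pt X); rewrite /c; lra.
  exists (phi (mm_pt X)); first by exists (mm_pt X).
  have := metric_tri mZ (psi (mm_pt Y)) (psi x) (phi (mm_pt X)).
  by rewrite ipsi (metric_sym mZ (psi (mm_pt Y))); have := NP x (mm_pt Y); rewrite /c; lra.
have [|e2 [e20 h3] e2r] := inf_adherent rt0 (E := S2).
  split; last by exists 0 => x [/ltW].
  have MX := mass_ge0 X setT; have MY := mass_ge0 Y setT.
  exists (mass X setT + mass Y setT + 1); split; first lra.
  move=> A mA; apply/massP => //; split.
  - have := mass_ge0 Y (psi @^-1` nbhd dZ (mass X setT + mass Y setT + 1) A).
    have := le_mass (isometry_borel iphi mA) (dborelT X) (@subsetT _ _); lra.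
  - have := mass_ge0 X (phi @^-1` nbhd dZ (mass X setT + mass Y setT + 1) A).
    have := le_mass (isometry_borel ipsi mA) (dborelT Y) (@subsetT _ _); lra.
exists Z, dZ, phi, psi, e2; split=> //; first by lra.
split=> [x|y|A mA]; last by apply/massP => //; exact: h3.
  have [|_ [y _ <-] xy] := h1 (phi x); first by exists x.
  by exists y; lra.
have [|_ [x _ <-] xy] := h2 (psi y); first by exists y.
by exists x; lra.
Qed.

(* A quantitative form of [mm_le X Y]. The values are open and only open sets are
   tested, so that all images are measurable and the relation composes. *)
Definition dominated (e : RR) (X Y : mmspace) : Prop :=
  exists R : mm_car X -> set (mm_car Y),
  [/\ forall x, dopen (@mm_d Y) (R x), forall x, R x !=set0,
      forall x x' y y', R x y -> R x' y' -> mm_d x x' <= mm_d y y' + e &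
      forall U, dopen (@mm_d X) U ->
        mass X U <= mass Y (\bigcup_(x in U) R x) + e].

Lemma dominatedW e e' X Y : e <= e' -> dominated e X Y -> dominated e' X Y.
Proof.
move=> ee' [R [Ro R0 Rd Rm]]; exists R; split=> // [x x' y y' xy xy'|U oU].
  by have := Rd _ _ _ _ xy xy'; lra.
by have := Rm _ oU; lra.
Qed.

Lemma dominated_trans e e' X Y Z :
  dominated e X Y -> dominated e' Y Z -> dominated (e + e') X Z.
Proof.
move=> [R [Ro R0 Rd Rm]] [S [So S0 Sd Sm]].
exists (fun x => \bigcup_(y in R x) S y); split.
- by move=> x; apply: dopen_bigcup => y _; exact: So.
- by move=> x; have [y xy] := R0 x; have [z yz] := S0 y; exists z, y.
- move=> x x' z z' [y xy yz] [y' xy' yz'].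
  by have := Rd _ _ _ _ xy xy'; have := Sd _ _ _ _ yz yz'; lra.
- move=> U oU; have oV : dopen (@mm_d Y) (\bigcup_(x in U) R x).
    by apply: dopen_bigcup => x _; exact: Ro.
  have := Rm _ oU; have := Sm _ oV.
  suff -> : \bigcup_(y in \bigcup_(x in U) R x) S y =
    \bigcup_(x in U) \bigcup_(y in R x) S y by lra.
  apply/seteqP; split=> z.
    by move=> [y [x Ux xy] yz]; exists x => //; exists y.
  by move=> [x Ux [y xy yz]]; exists y => //; exists x.
Qed.

(** The relation is the inverse of the contraction [phi], thickened by [e / 2] so that its values
    are open. *)
Lemma mm_le_dominated e X Y : 0 < e -> mm_le X Y -> dominated e X Y.
Proof.
move=> e0 [phi [phiS phiL phiM]]; have [mX mY] := (mm_metric X, mm_metric Y).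
have Ro x : dopen (@mm_d Y) [set y | mm_d x (phi y) < e / 2].
  move=> y /= xy; exists (e / 2 - mm_d x (phi y)); split=> [|z yz]; first by lra.
  by have := metric_tri mX (phi y) x (phi z); have := phiL y z; rewrite /=; lra.
exists (fun x => [set y | mm_d x (phi y) < e / 2]); split=> //.
- by move=> x; have [y <-] := phiS x; exists y; rewrite /= metric_xx//; lra.
- move=> x x' y y' /= xy xy'; have := phiL y y'.
  have := metric_tri mX (phi y) x x'; have := metric_tri mX (phi y') (phi y) x'.
  by rewrite (metric_sym mX (phi y') x'); lra.
move=> U oU; have mU := dborel_dopen oU.
have mpU := dborel_preimage_lipschitz phiL mU.
have := phiM _ mU; rewrite !massE// lee_fin => /le_trans; apply.
apply: ler_wpDr; first exact: ltW.
apply: le_mass => //.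
  by apply: dborel_dopen; apply: dopen_bigcup => x _; exact: Ro.
by move=> y Uy; exists (phi y) => //=; rewrite metric_xx//; lra.
Qed.

(** Points are related when their images in [Z] are [t]-close. The room between [e] and [t] serves
    to thicken the image of an open set. *)
Lemma dominated_embed (X Y : mmspace) (Z : Type) (dZ : Z -> Z -> RR)
    (phi : mm_car X -> Z) (psi : mm_car Y -> Z) (e t : RR) :
  is_metric dZ -> Defs.isometry (@mm_d X) dZ phi -> Defs.isometry (@mm_d Y) dZ psi ->
  0 < e < t ->
  (forall x, exists y, dZ (phi x) (psi y) < t) ->
  (forall A, dborel dZ A ->
    mass X (phi @^-1` A) <= mass Y (psi @^-1` nbhd dZ e A) + e) ->
  dominated (2 * t) X Y.
Proof.
move=> mZ iphi ipsi /andP[e0 et] h1 hA.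
have Ro x : dopen (@mm_d Y) [set y | dZ (phi x) (psi y) < t].
  move=> y /= xy; exists (t - dZ (phi x) (psi y)); split=> [|z yz]; first by lra.
  by have := metric_tri mZ (psi y) (phi x) (psi z); rewrite /= ipsi; lra.
exists (fun x => [set y | dZ (phi x) (psi y) < t]); split=> //.
  move=> x x' y y' /= xy xy'; rewrite -iphi -ipsi.
  have := metric_tri mZ (psi y) (phi x) (phi x').
  have := metric_tri mZ (psi y') (psi y) (phi x').
  by rewrite (metric_sym mZ (psi y') (phi x')); lra.
move=> U oU.
(* [A] is open, hence Borel, and contains the image of [U]. Since its balls have radius at most
   [t - e], its [e]-neighbourhood stays within [t] of that image. *)
pose A : set Z := [set z | exists x r, [/\ forall x', mm_d x x' < r -> U x',
  r <= t - e & dZ (phi x) z < r]].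
have oA : dopen dZ A.
  move=> z [x [r [xU re xz]]]; exists (r - dZ (phi x) z); split; first lra.
  move=> z' zz'; exists x, r; split=> //.
  by have := metric_tri mZ z (phi x) z'; lra.
have mA := dborel_dopen oA.
apply: (@le_trans _ _ (mass X (phi @^-1` A))).
  apply: le_mass; [exact: dborel_dopen|exact: isometry_borel iphi _|].
  move=> x Ux; have [r [r0 rU]] := oU _ Ux.
  exists x, (Num.min r (t - e)); rewrite metric_xx//; split.
  - by move=> x' xx'; apply: rU; rewrite (lt_le_trans xx')// ge_min lexx.
  - by rewrite ge_min lexx orbT.
  - by rewrite lt_min r0; lra.
apply: le_trans (hA _ mA) _; apply: lerD; last by lra.
apply: le_mass.
- apply: isometry_borel ipsi _; apply: dborel_dopen; exact: dopen_nbhd.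
- by apply: dborel_dopen; apply: dopen_bigcup => x _; exact: Ro.
move=> y [z [x [r [xU re xz]] yz]]; exists x.
  by apply: xU; rewrite (metric_xx (mm_metric X)); have := metric_ge0 mZ (phi x) z; lra.
by have := metric_tri mZ z (phi x) (psi y); rewrite /= (metric_sym mZ z); lra.
Qed.

Lemma dGHP_dominated X Y t : dGHP X Y < t ->
  dominated (2 * t) X Y /\ dominated (2 * t) Y X.
Proof.
move=> /dGHP_lt[Z [dZ [phi [psi [e [mZ iphi ipsi et [h1 h2 h3]]]]]]]; split.
  by apply: (dominated_embed mZ iphi ipsi et) => // A /h3[].
by apply: (dominated_embed mZ ipsi iphi et) => // A /h3[].
Qed.

(** The composite of the two relations is approximately expanding from [X] to itself, so
    [expanding_self] makes it nearly isometric and onto. Then so is [R], and the spaces are glued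
    along it. Only the compactness of [X] determines [eta]. *)
Lemma dominated_antisym (X : mmspace) (e : RR) : 0 < e -> exists2 eta, 0 < eta &
  forall Y, dominated eta X Y -> dominated eta Y X -> dGHP X Y < e.
Proof.
move=> e0; have mX := mm_metric X.
(* The Hausdorff and Prokhorov parts will each cost [4 * g]. *)
pose g := e / 10; have g0 : 0 < g by rewrite /g; lra.
have [eta1 eta10 selfP] := expanding_self mX (@mm_compact X) g0.
pose eta := Num.min (eta1 / 2) g.
have [etag eta1e] : eta <= g /\ 2 * eta <= eta1.
  split; first by rewrite /eta ge_min lexx orbT.
  have : eta <= eta1 / 2 by rewrite /eta ge_min lexx.
  by lra.
have eta0 : 0 < eta by rewrite /eta lt_min g0 andbT; lra.
exists eta => // Y [R [Ro R0 Rd Rm]] [S [So S0 Sd Sm]].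
have mY := mm_metric Y.
pose T x z := exists y, R x y /\ S y z.
have [||Tiso Tonto] := selfP T.
- by move=> x; have [y xy] := R0 x; have [z yz] := S0 y; exists z, y.
- move=> x x' z z' [y [xy yz]] [y' [xy' yz']].
  by have := Rd _ _ _ _ xy xy'; have := Sd _ _ _ _ yz yz'; lra.
have RXY x x' y y' : R x y -> R x' y' -> mm_d x x' <= mm_d y y' + 2 * g.
  by move=> xy xy'; have := Rd _ _ _ _ xy xy'; lra.
have RYX x x' y y' : R x y -> R x' y' -> mm_d y y' <= mm_d x x' + 2 * g.
  move=> xy xy'; have [[z yz] [z' yz']] := (S0 y, S0 y').
  have := Sd _ _ _ _ yz yz'.
  have := Tiso x x' z z' (ex_intro _ y (conj xy yz)) (ex_intro _ y' (conj xy' yz')).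
  by lra.
have Ronto y : exists b y1, R b y1 /\ mm_d y1 y <= 2 * g.
  (* [S] sends [y] to [a] and [y1] to [c]; as [a] and [c] are close and [S] nearly expands, [y1] is
     close to [y]. *)
  have [a ya] := S0 y; have [b [c [[y1 [by1 y1c]] ac]]] := Tonto a.
  exists b, y1; split=> //; have := Sd _ _ _ _ ya y1c.
  by rewrite (metric_sym mY y1); lra.
have Rne : exists x y, R x y.
  by have [y xy] := R0 (mm_pt X); exists (mm_pt X), y.
pose dZ := glue_dist (@mm_d X) (@mm_d Y) R g.
have mZ : is_metric dZ by exact: glue_dist_metric.
have crossP x x' y y' : R x' y' -> mm_d x x' + mm_d y' y < 3 * g ->
    dZ (inl x) (inr y) < 4 * g.
  move=> xy lt; rewrite /dZ /=; apply: le_lt_trans (cross_dist_le mX mY g x y xy) _.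
  by lra.
have crossP' x x' y y' : R x' y' -> mm_d x x' + mm_d y' y < 3 * g ->
    dZ (inr y) (inl x) < 4 * g by exact: crossP.
suff : dGHP X Y <= 4 * g + 4 * g by rewrite /g; lra.
apply: (dGHP_le (phi := inl) (psi := inr) mZ) => //; do ?by lra.
- move=> x; have [y xy] := R0 x; exists y; apply: crossP xy _.
  by rewrite ?(metric_xx mX) ?(metric_xx mY); lra.
- move=> y; have [b [y1 [by1 yy1]]] := Ronto y; exists b; apply: crossP' by1 _.
  by rewrite ?(metric_xx mX) ?(metric_xx mY); lra.
move=> A mA.
have iX : Defs.isometry (@mm_d X) dZ inl by [].
have iY : Defs.isometry (@mm_d Y) dZ inr by [].
have mAX := isometry_borel iX mA; have mAY := isometry_borel iY mA.
have mN : dborel dZ (nbhd dZ (4 * g) A).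
  by apply: dborel_dopen; exact: dopen_nbhd.
have mNX := isometry_borel iX mN; have mNY := isometry_borel iY mN.
have mR V : dborel (@mm_d Y) (\bigcup_(x in V) R x).
  by apply: dborel_dopen; apply: dopen_bigcup => x _; exact: Ro.
split.
  pose V := nbhd (@mm_d X) g (inl @^-1` A).
  have oV : dopen (@mm_d X) V by exact: dopen_nbhd.
  have : mass X (inl @^-1` A) <= mass X V.
    apply: le_mass => //; first exact: dborel_dopen.
    by move=> x Ax; exists x => //; rewrite metric_xx.
  have : mass Y (\bigcup_(x in V) R x) <= mass Y (inr @^-1` nbhd dZ (4 * g) A).
    apply: le_mass => // y [v [x Ax vx] vy]; exists (inl x) => //.
    apply: crossP' vy _; rewrite (metric_xx mY) (metric_sym mX x).
    by lra.
  by have := Rm V oV; lra.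
(* [R] only controls the masses of [X] by those of [Y]; since the total masses
   are close, the reverse bound follows by passing to complements. *)
pose B : set (mm_car Y) := inr @^-1` A.
pose C := [set x | exists2 y, B y & R x y].
(* [V] is open and misses [C], so its image under [R] misses [B], while the complement of [V] lies
   within [2 * g] of [C]. *)
pose V := nbhd (@mm_d X) g (~` nbhd (@mm_d X) (2 * g) C).
have oV : dopen (@mm_d X) V by exact: dopen_nbhd.
have mV := dborel_dopen oV.
have VC x : V x -> ~ C x.
  by move=> [z zC xz] Cx; apply: zC; exists x => //; rewrite metric_sym//; lra.
have : mass Y (\bigcup_(x in V) R x) + mass Y B <= mass Y setT.
  rewrite -massU//; last first.
    by apply/seteqP; split=> // y [[x Vx xy] By]; apply: (VC _ Vx); exists y.
  by apply: le_mass => //; [exact: dborelU|exact: dborelT].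
have : mass X (~` V) <= mass X (inl @^-1` nbhd dZ (4 * g) A).
  apply: le_mass => //; first exact: dborelC.
  move=> x nVx; have [c [y By cy] xc] : nbhd (@mm_d X) (2 * g) C x.
    apply: contrapT => h; apply: nVx; exists x => //.
    by rewrite metric_xx.
  exists (inr y) => //; apply: crossP cy _; rewrite (metric_xx mY).
  by lra.
(* Applied to the whole of [Y], [S] bounds the total mass of [Y] by that of [X], up to [eta]. *)
have oT : dopen (@mm_d Y) setT by move=> y _; exists 1.
have ST : mass X (\bigcup_(y in setT) S y) <= mass X setT.
  apply: le_mass => //; last exact: dborelT.
  by apply: dborel_dopen; apply: dopen_bigcup => y _; exact: So.
have := Sm _ oT; have := Rm V oV; rewrite (massC mV) in ST.
by rewrite -/B; lra.
Qed.

(** * Countable covers by finite codes *)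

Section code.
Variable g : RR.
Hypothesis g0 : 0 < g.

(* Up to rounding, [D] and [M] list the distances in a finite [g]-net of [X] and
   the masses of the unions of [g]-balls around its points. *)
Definition coded_by (n : nat) (D : 'I_n * 'I_n -> nat) (M : {set 'I_n} -> nat)
    (X : mmspace) : Prop :=
  exists p : 'I_n -> mm_car X,
  [/\ forall x, exists i, mm_d (p i) x < g,
      forall i j, Num.truncn (mm_d (p i) (p j) / g) = D (i, j) &
      forall I : {set 'I_n}, Num.truncn
        (mass X (\bigcup_(i in [set i | i \in I]) [set x | mm_d (p i) x < g]) / g) = M I].

Lemma truncn_eq_le (a b : RR) : 0 <= a -> 0 <= b ->
  Num.truncn (a / g) = Num.truncn (b / g) -> a <= b + g.
Proof.
move=> a0 b0 E.
have /andP[_ ha] := truncn_itv (divr_ge0 a0 (ltW g0)).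
have /andP[hb _] := truncn_itv (divr_ge0 b0 (ltW g0)).
rewrite E in ha; rewrite -natr1 ltr_pdivrMr// in ha.
by rewrite ler_pdivlMr// in hb; lra.
Qed.

(** Points are related when they lie in balls with a common index. Rounding costs [g] and the
    passage through net points four radii. The mass of [U] is compared through the union of the
    balls that meet [U]. *)
Lemma coded_by_dominated n D M X Y :
  @coded_by n D M X -> @coded_by n D M Y -> dominated (5 * g) X Y.
Proof.
move=> [p [pn pD pM]] [q [qn qD qM]]; have [mX mY] := (mm_metric X, mm_metric Y).
have Ro x : dopen (@mm_d Y)
    (\bigcup_(i in [set i | mm_d (p i) x < g]) [set y | mm_d (q i) y < g]).
  by apply: dopen_bigcup => i _; exact: dopen_ball.
exists (fun x => \bigcup_(i in [set i | mm_d (p i) x < g]) [set y | mm_d (q i) y < g]).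
split=> //.
- move=> x; have [i xi] := pn x; exists (q i), i => //=.
  by rewrite metric_xx.
- move=> x x' y y' [i /= xi yi] [j /= xj yj].
  have : mm_d (p i) (p j) <= mm_d (q i) (q j) + g.
    by apply: truncn_eq_le; rewrite ?metric_ge0// pD qD.
  have := metric_tri mX (p i) x x'; have := metric_tri mX (p j) (p i) x'.
  have := metric_tri mY y (q i) (q j); have := metric_tri mY y' y (q j).
  by rewrite (metric_sym mX x (p i)) (metric_sym mY y' (q j)); lra.
move=> U oU; pose I := finset (fun i => `[< exists2 x, U x & mm_d (p i) x < g >]).
have Io (Z : mmspace) (r : 'I_n -> mm_car Z) :
    dborel (@mm_d Z) (\bigcup_(i in [set i | i \in I]) [set x | mm_d (r i) x < g]).
  apply: dborel_dopen; apply: dopen_bigcup => i _; apply: dopen_ball.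
  exact: mm_metric.
have UI : mass X U <= mass X (\bigcup_(i in [set i | i \in I]) [set x | mm_d (p i) x < g]).
  apply: le_mass => //; first exact: dborel_dopen.
  move=> x Ux; have [i xi] := pn x; exists i => //=.
  by rewrite finset.inE; apply/asboolP; exists x.
apply: (le_trans UI); apply: le_trans (truncn_eq_le _ _ _) _.
- exact: mass_ge0.
- exact: (mass_ge0 Y (\bigcup_(i in [set i | i \in I]) [set x | mm_d (q i) x < g])).
- by rewrite pM qM.
apply: lerD; last by have := g0; lra.
apply: le_mass => //.
  by apply: dborel_dopen; apply: dopen_bigcup => x _; exact: Ro.
move=> y [i /=]; rewrite finset.inE => /asboolP[x Ux xi] yi.
by exists x => //; exists i.
Qed.

End code.

(** A code consists of finitely many natural numbers, so codes are countable. An index that decodes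
    to nothing gets the empty class. *)
Lemma dominated_countable_cover (e : RR) : 0 < e ->
  exists C : nat -> mmspace -> Prop, (forall X, exists k, C k X) /\
    forall k X Y, C k X -> C k Y -> dominated e X Y.
Proof.
move=> e0; have g0 : 0 < e / 5 by lra.
pose code := {n : nat & ({ffun 'I_n * 'I_n -> nat} * {ffun {set 'I_n} -> nat})%type}.
exists (fun k X => if (unpickle k : option code) is Some (existT n DM)
  then coded_by (e / 5) DM.1 DM.2 X else False); split=> [X|k X Y].
  have [n [p pP]] := dcompact_net (mm_metric X) (@mm_compact X) g0.
  pose c : code := existT _ n (
    [ffun ij : 'I_n * 'I_n => Num.truncn (mm_d (p ij.1) (p ij.2) / (e / 5))],
    [ffun I : {set 'I_n} => Num.truncn (mass X
      (\bigcup_(i in [set i | i \in I]) [set x | mm_d (p i) x < e / 5]) / (e / 5))]).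
  by exists (pickle c); rewrite pickleK; exists p; split=> // *; rewrite ffunE.
case: (unpickle k) => // -[n DM] CX CY.
by rewrite (_ : e = 5 * (e / 5)); [exact: coded_by_dominated CX CY|lra].
Qed.

(* Truncated at [1], so that the infimum is never over an empty set. *)
Definition gap (X Y : mmspace) : RR :=
  inf [set e | e = 1 \/ 0 < e /\ dominated e X Y].

Lemma gap_has_inf X Y : has_inf [set e : RR | e = 1 \/ 0 < e /\ dominated e X Y].
Proof.
by split; [exists 1; left | exists 0 => e [->|[/ltW]]].
Qed.

Lemma gap_ge0 X Y : 0 <= gap X Y.
Proof. by apply: inf_pos_ge0 => e [->|[]]. Qed.

Lemma gap_le e X Y : 0 < e -> dominated e X Y -> gap X Y <= e.
Proof. by move=> e0 XY; apply: ge_inf; [case: (gap_has_inf X Y)|right]. Qed.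

Lemma gap_le1 X Y : gap X Y <= 1.
Proof. by apply: ge_inf; [case: (gap_has_inf X Y)|left]. Qed.

Lemma gap_lt e X Y : gap X Y < e -> e <= 1 -> dominated e X Y.
Proof.
rewrite -subr_gt0 => e0 e1.
have [r] := inf_adherent e0 (gap_has_inf X Y).
rewrite -/(gap X Y) addrC subrK => -[->|[_ XY] re].
  by move/lt_le_trans => /(_ _ e1); rewrite ltxx.
exact: dominatedW (ltW re) XY.
Qed.

Lemma gap_tri Y X Z : gap X Z <= gap X Y + gap Y Z.
Proof.
apply/ler_addgt0Pr => t t0; have t20 : 0 < t / 2 by lra.
(* Once a term reaches the truncation value, [gap_le1] is enough. *)
have [XY1|XY1] := ltP (gap X Y + t / 2) 1; last first.
  by have := gap_le1 X Z; have := gap_ge0 Y Z; lra.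
have [YZ1|YZ1] := ltP (gap Y Z + t / 2) 1; last first.
  by have := gap_le1 X Z; have := gap_ge0 X Y; lra.
have XY : dominated (gap X Y + t / 2) X Y by apply: gap_lt (ltW _) => //; lra.
have YZ : dominated (gap Y Z + t / 2) Y Z by apply: gap_lt (ltW _) => //; lra.
rewrite (_ : _ + t = gap X Y + t / 2 + (gap Y Z + t / 2)); last by lra.
apply: gap_le; last exact: dominated_trans XY YZ.
by have := gap_ge0 X Y; have := gap_ge0 Y Z; lra.
Qed.

Lemma gap_mm_le X Y : mm_le X Y -> gap X Y = 0.
Proof.
move=> XY; apply/eqP; rewrite eq_le gap_ge0 andbT.
apply/ler_addgt0Pr => t t0; rewrite add0r.
by apply: gap_le => //; exact: mm_le_dominated.
Qed.

Lemma gap_dGHP X Y t : dGHP X Y < t -> gap X Y <= 2 * t /\ gap Y X <= 2 * t.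
Proof.
move=> XYt; have t0 : 0 < t.
  apply: le_lt_trans XYt; apply: lb_le_inf (dGHP_defined X Y) _.
  move=> _ [Z' [dZ' [phi' [psi' [_ _ _ ->]]]]].
  by apply: addr_ge0; apply: inf_pos_ge0 => x [].
have [XY YX] := dGHP_dominated XYt.
by split; apply: gap_le => //; lra.
Qed.

Lemma gap_dGHP_small (X : mmspace) (e : RR) : 0 < e -> exists2 r, 0 < r &
  forall Y, gap X Y < r -> gap Y X < r -> dGHP X Y < e.
Proof.
move=> /(dominated_antisym X)[eta eta0 etaP].
exists (Num.min eta 1) => [|Y XY YX]; first by rewrite lt_min eta0 ltr01.
have e1 : Num.min eta 1 <= eta by rewrite ge_min lexx.
have e2 : Num.min eta 1 <= 1 :> RR by rewrite ge_min lexx orbT.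
by apply: etaP; apply: dominatedW e1 _; exact: gap_lt.
Qed.

(** For each scale [m.+1%:R^-1] and each class of the cover at that scale, keep one member of [U]
    whose radius exceeds the scale, if there is one. A point [Y] is reached at any scale below
    [r Y], through the member kept in its class. *)
Lemma gap_lindelof (U : set mmspace) (r : mmspace -> RR) : (forall X, 0 < r X) ->
  exists2 x : nat -> option mmspace, (forall k X, x k = Some X -> U X) &
  forall Y, U Y -> exists k X, [/\ x k = Some X, gap X Y < r X & gap Y X < r X].
Proof.
move=> r0.
have e0 (m : nat) : 0 < m.+1%:R^-1 :> RR by rewrite invr_gt0.
have /choice[C CP] := fun m => dominated_countable_cover (e0 m).
pose good m k X := [/\ U X, C m k X & m.+1%:R^-1 < r X].
pose x0 (mk : nat * nat) : option mmspace :=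
  if pselect (exists X, good mk.1 mk.2 X) is left h then Some (projT1 (cid h)) else None.
exists (fun k => if unpickle k is Some mk then x0 mk else None).
  move=> k X; case: (unpickle k) => // mk; rewrite /x0.
  by case: pselect => // h [<-]; case: (projT2 (cid h)).
move=> Y UY; have [m mP] : exists m, m.+1%:R^-1 < r Y.
  exists (Num.truncn (r Y)^-1).
  by rewrite invf_plt ?posrE// truncnS_gt.
have [k kY] := (CP m).1 Y.
have h : exists X, good m k X by exists Y.
exists (pickle (m, k)), (projT1 (cid h)); rewrite pickleK /x0 /=.
case: pselect => // h'; rewrite (Prop_irrelevance h' h).
have [_ CX rX] := projT2 (cid h); split=> //.
  by apply: le_lt_trans rX; apply: gap_le => //; exact: (CP m).2 CX kY.
by apply: le_lt_trans rX; apply: gap_le => //; exact: (CP m).2 kY CX.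
Qed.

(** * Means of bounded functions *)

Lemma cvg_EFin_dist (R : realType) (u : nat -> R) (l : R) :
  (fun n => (u n)%:E) @ \oo --> l%:E <->
  forall e, 0 < e -> exists N, forall n, (N <= n)%N -> `|u n - l| < e.
Proof.
split=> [/fine_cvg /cvgrPdist_lt h e /h [N _ NP]|h].
  by exists N => n /NP; rewrite distrC.
apply/fine_cvgP; split; first by apply: nearW.
apply/cvgrPdist_lt => e /h [N NP]; exists N => // n /= /NP.
by rewrite distrC.
Qed.

Section probability.
Context {d} {T : measurableType d} {R : realType}.
Implicit Types (P Q : probability T R) (f g : T -> R).

Lemma measurable_fun_gt f :
  (forall r, measurable [set x | r < f x]) -> measurable_fun setT f.
Proof.
move=> mf mT; apply: (measurability _ (RGenOInfty.measurableE R)) => //.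
move=> _ [_ [r ->] <-]; rewrite setTI (_ : _ @^-1` _ = [set x | r < f x])//.
by apply/seteqP; split=> x /=; rewrite in_itv/= andbT.
Qed.

(** Layer-cake formula: the mean of a nonnegative function is the integral of its tails. *)
Lemma le_integral_tails P Q g : measurable_fun setT g -> (forall x, 0 <= g x) ->
  (forall r, (P [set x | (r < g x)%R] <= Q [set x | (r < g x)%R])%E) ->
  (\int[P]_x (g x)%:E <= \int[Q]_x (g x)%:E)%E.
Proof.
move=> mg g0 PQ.
pose XP : {RV P >-> R} := mfun_Sub (mem_set mg).
pose XQ : {RV Q >-> R} := mfun_Sub (mem_set mg).
have := @ge0_expectation_ccdf _ _ _ _ XP g0; rewrite expectation_def => ->.
have := @ge0_expectation_ccdf _ _ _ _ XQ g0; rewrite expectation_def => ->.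
apply: ge0_le_integral => //; try by apply: measurable_funTS; exact: ccdf_measurable.
move=> r _; rewrite /ccdf /distribution /pushforward /=.
have E : g @^-1` `]r, +oo[ = [set x | r < g x].
  by apply/seteqP; split=> x /=; rewrite in_itv/= andbT.
by rewrite E.
Qed.

Definition bounded_measurable f :=
  measurable_fun setT f /\ exists C, forall x, `|f x| <= C.

Lemma bounded_measurable_integrable P f : bounded_measurable f ->
  P.-integrable setT (EFin \o f).
Proof.
move=> [mf [C fC]]; apply: measurable_bounded_integrable => //.
  by apply: le_lt_trans (probability_le1 P measurableT) _; rewrite ltry.
by exists C; split; [exact: num_real|move=> x Cx y _; exact: le_trans (fC y) (ltW Cx)].
Qed.

Lemma integral_mean P f : bounded_measurable f ->
  (\int[P]_x (f x)%:E)%E = (\int[P]_x f x)%:E.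
Proof.
move=> /(bounded_measurable_integrable P) fi.
by rewrite /Rintegral fineK//; exact: integrable_fin_num.
Qed.

Lemma bounded_measurable_lin a f b g : bounded_measurable f ->
  bounded_measurable g -> bounded_measurable (fun x => a * f x + b * g x).
Proof.
move=> [mf [C fC]] [mg [D gD]]; split.
  by apply: measurable_funD; apply: measurable_funM => //; exact: measurable_cst.
exists (`|a| * C + `|b| * D) => x; apply: le_trans (ler_normD _ _) _.
by rewrite !normrM lerD// ler_wpM2l.
Qed.

Lemma mean_lin P a f b g : bounded_measurable f -> bounded_measurable g ->
  \int[P]_x (a * f x + b * g x) = a * \int[P]_x f x + b * \int[P]_x g x.
Proof.
move=> bf bg.
have bz c h : bounded_measurable h -> bounded_measurable (fun x => c * h x).
  move=> bh; have := bounded_measurable_lin c 0 bh bh; congr bounded_measurable.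
  by apply/funext => x; rewrite mul0r addr0.
rewrite RintegralD//; do ?by apply: bounded_measurable_integrable; exact: bz.
by rewrite !RintegralZl//; exact: bounded_measurable_integrable.
Qed.

Lemma le_mean P f g : bounded_measurable f -> bounded_measurable g ->
  (forall x, f x <= g x) -> \int[P]_x f x <= \int[P]_x g x.
Proof.
by move=> bf bg fg; apply: le_Rintegral => //; exact: bounded_measurable_integrable.
Qed.

Lemma mean_cst P c : \int[P]_x (cst c x) = c.
Proof.
rewrite Rintegral_cst// (_ : fine _ = 1) ?mulr1//.
exact: (congr1 fine (probability_setT P)).
Qed.

(** Dominated convergence, with the constant [1] as dominating function. *)
Lemma mean_cvg0 P (r : nat -> T -> R) : (forall n, measurable_fun setT (r n)) ->
  (forall n x, 0 <= r n x <= 1) ->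
  (forall x, exists N, forall n, (N <= n)%N -> r n x = 0) ->
  forall e, 0 < e -> exists N, \int[P]_x r N x < e.
Proof.
move=> mr r01 r0 e e0.
have br n : bounded_measurable (r n).
  split=> //; exists 1 => x; have /andP[? ?] := r01 n x.
  by rewrite ger0_norm.
have := @dominated_cvg _ _ _ P setT measurableT (fun n x => (r n x)%:E)
  (cst 0%E) (cst 1%E).
rewrite integral_cst// mul0e => h.
have : (\int[P]_x (r n x)%:E)%E @[n --> \oo] --> 0%E.
  apply: h => //.
  - by move=> n; apply/measurable_EFinP.
  - move=> x _; apply/cvg_EFin_dist => t t0; have [N NP] := r0 x.
    by exists N => n /NP ->; rewrite subrr normr0.
  - exact: (finite_measure_integrable_cst P 1).
  - move=> n x _ /=; have /andP[? ?] := r01 n x.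
    by rewrite lee_fin ger0_norm.
rewrite (_ : (fun n => _) = fun n => (\int[P]_x r n x)%:E); last first.
  by apply/funext => n; rewrite integral_mean.
move=> /cvg_EFin_dist /(_ _ e0)[N /(_ N (leqnn _))].
by rewrite subr0 => /ltr_normlW; exists N.
Qed.

End probability.

(** * Increasing test functions *)

Lemma ghp_continuous_measurable (f : MGHP -> RR) :
  ghp_continuous f -> measurable_fun setT (f : MGHP -> (RR : realType)).
Proof.
move=> cf; apply: measurable_fun_gt => r; apply: sub_sigma_algebra => x /=.
rewrite -subr_gt0 => rx; have [dl dl0 xdl] := cf x _ rx.
by exists dl; split=> // y /xdl; rewrite ltr_norml; lra.
Qed.

Lemma gap_continuous_r X : ghp_continuous (fun Y => gap X Y).
Proof.
move=> Y e e0; have e40 : 0 < e / 4 by lra.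
exists (e / 4) => // Z /gap_dGHP[YZ ZY].
have := gap_tri Y X Z; have := gap_tri Z X Y.
by rewrite ltr_norml; lra.
Qed.

Lemma gap_continuous_l X : ghp_continuous (fun Y => gap Y X).
Proof.
move=> Y e e0; have e40 : 0 < e / 4 by lra.
exists (e / 4) => // Z /gap_dGHP[YZ ZY].
have := gap_tri Y Z X; have := gap_tri Z Y X.
by rewrite ltr_norml; lra.
Qed.

Definition clamp (t : RR) : RR := Num.min 1 (Num.max 0 t).

Lemma clamp01 t : 0 <= clamp t <= 1.
Proof. by rewrite /clamp ge_min lexx le_min ler01 le_max lexx. Qed.

Lemma clamp_ge1 t : 1 <= t -> clamp t = 1.
Proof. by move=> t1; rewrite /clamp max_r ?min_l//; lra. Qed.

Lemma clamp_le0 t : t <= 0 -> clamp t = 0.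
Proof. by move=> t0; rewrite /clamp max_l// min_r. Qed.

Lemma clamp_mono s t : s <= t -> clamp s <= clamp t.
Proof. by move=> st; rewrite /clamp; apply: le_min2 => //; apply: le_max2. Qed.

Lemma clamp_dist s t : `|clamp s - clamp t| <= `|s - t|.
Proof.
wlog st : s t / s <= t.
  move=> W; have [|/ltW] := leP s t; first exact: W.
  by move=> /W; rewrite distrC [X in _ <= X]distrC.
rewrite !ler0_norm ?subr_le0 ?clamp_mono//.
rewrite /clamp; case: (leP 0 s) => ?; case: (leP 0 t) => ?;
  case: (leP 1 s) => ?; case: (leP 1 t) => ?; case: (leP 1 (0 : RR)) => ?; lra.
Qed.

(* Nonnegativity makes this class closed under products. *)
Definition increasing_test (g : MGHP -> RR) : Prop :=
  [/\ ghp_continuous g, forall X, 0 <= g X <= 1 &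
      forall X Y, mm_le X Y -> g X <= g Y].

Lemma increasing_test_cst c : 0 <= c <= 1 -> increasing_test (fun=> c).
Proof.
move=> c01; split=> // X e e0; exists 1 => // Y _.
by rewrite subrr normr0.
Qed.

Lemma increasing_test1 : increasing_test (fun=> 1).
Proof. by apply: increasing_test_cst; rewrite ler01 lexx. Qed.

Lemma increasing_testM f g : increasing_test f -> increasing_test g ->
  increasing_test (fun X => f X * g X).
Proof.
move=> [cf f01 fm] [cg g01 gm]; split=> [X e e0|X|X Y XY].
- have e20 : 0 < e / 2 by lra.
  have [dl dl0 fX] := cf X _ e20; have [dl' dl'0 gX] := cg X _ e20.
  exists (Num.min dl dl') => [|Y]; first by rewrite lt_min dl0.
  rewrite lt_min => /andP[/fX + /gX].
  have /andP[fX0 fX1] := f01 X; have /andP[gY0 gY1] := g01 Y.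
  rewrite (_ : f X * g X - f Y * g Y = f X * (g X - g Y) + (f X - f Y) * g Y); last by ring.
  move=> hf hg; apply: le_lt_trans (ler_normD _ _) _; rewrite !normrM.
  rewrite (ger0_norm fX0) (ger0_norm gY0).
  have : f X * `|g X - g Y| <= `|g X - g Y| by rewrite ler_piMl.
  have : `|f X - f Y| * g Y <= `|f X - f Y| by rewrite ler_piMr.
  by lra.
- have /andP[fX0 fX1] := f01 X; have /andP[gX0 gX1] := g01 X.
  by rewrite mulr_ge0//= mulr_ile1.
- have /andP[fX0 fX1] := f01 X; have /andP[gX0 gX1] := g01 X.
  by rewrite ler_pM ?fm ?gm.
Qed.

Lemma clamp_continuous (f : MGHP -> RR) a b :
  ghp_continuous f -> ghp_continuous (fun X => clamp (a + b * f X)).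
Proof.
move=> cf X e e0; have b0 : 0 < `|b| + 1 by have := normr_ge0 b; lra.
have [|dl dl0 fX] := cf X (e / (`|b| + 1)); first by rewrite divr_gt0.
exists dl => // Y /fX hY; apply: le_lt_trans (clamp_dist _ _) _.
rewrite (_ : _ - _ = b * (f X - f Y)) ?normrM; last by ring.
move: hY; rewrite ltr_pdivlMr// => hY; apply: le_lt_trans hY.
by rewrite mulrC ler_wpM2l//; lra.
Qed.

(** Monotonicity is the triangle inequality for [gap], which vanishes along [mm_le]. *)
Lemma increasing_test_gap_r X r : 0 < r ->
  increasing_test (fun Y => clamp (2 - r^-1 * gap X Y)).
Proof.
move=> r0; split=> [|Y|Y Z YZ]; last 1 first.
- apply: clamp_mono; rewrite lerD2l lerN2 ler_pM2l ?invr_gt0//.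
  by have := gap_tri Y X Z; rewrite (gap_mm_le YZ); lra.
- have := clamp_continuous 2 (- r^-1) (@gap_continuous_r X).
  by under eq_fun do rewrite mulNr.
- exact: clamp01.
Qed.

Lemma increasing_test_gap_l X r : 0 < r ->
  increasing_test (fun Y => clamp (r^-1 * gap Y X - 1)).
Proof.
move=> r0; split=> [|Y|Y Z YZ]; last 1 first.
- apply: clamp_mono; rewrite lerD2r ler_pM2l ?invr_gt0//.
  by have := gap_tri Z Y X; rewrite (gap_mm_le YZ); lra.
- have := clamp_continuous (-1) r^-1 (@gap_continuous_l X).
  by under eq_fun do rewrite addrC.
- exact: clamp01.
Qed.

(** Turns the decreasing cutoff in [gap Y X] into one minus an increasing test, which places it in
    the span. *)
Lemma clamp_opp t : clamp (t - 1) = 1 - clamp (2 - t).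
Proof.
rewrite /clamp; case: (leP 0 (t - 1)) => ?; case: (leP 0 (2 - t)) => ?;
  case: (leP 1 (t - 1)) => ?; case: (leP 1 (2 - t)) => ?;
  case: (leP 1 (0 : RR)) => ?; lra.
Qed.

Inductive increasing_span : (MGHP -> RR) -> Prop :=
| span_test g : increasing_test g -> increasing_span g
| span_lin a f b g : increasing_span f -> increasing_span g ->
    increasing_span (fun X => a * f X + b * g X).

Lemma increasing_spanM f g : increasing_span f -> increasing_span g ->
  increasing_span (fun X => f X * g X).
Proof.
move=> sf; elim: sf g => {f} [f tf g sg|a f1 b f2 _ IH1 _ IH2 g sg].
  elim: sg => {g} [g tg|a g1 b g2 _ IH1 _ IH2].
    by apply: span_test; exact: increasing_testM.
  have := span_lin a b IH1 IH2; congr increasing_span.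
  by apply/funext => X; ring.
have := span_lin a b (IH1 _ sg) (IH2 _ sg); congr increasing_span.
by apply/funext => X; ring.
Qed.

Lemma increasing_test_bounded_measurable g : increasing_test g ->
  bounded_measurable g.
Proof.
move=> [cg g01 _]; split; first exact: ghp_continuous_measurable.
by exists 1 => X; have /andP[? ?] := g01 X; rewrite ger0_norm.
Qed.

Lemma increasing_span_bounded_measurable f : increasing_span f ->
  bounded_measurable f.
Proof.
elim=> {f} [g /increasing_test_bounded_measurable//|a f b g _ bf _ bg].
exact: bounded_measurable_lin.
Qed.

(** The superlevel sets of an increasing test are open and increasing, so its tails are ordered. *)
Lemma stoch_le_mean (P Q : probability MGHP RR) g : stoch_le P Q ->
  increasing_test g -> \int[P]_x g x <= \int[Q]_x g x.
Proof.
move=> PQ tg; have bg := increasing_test_bounded_measurable tg.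
have [cg g01 gm] := tg; rewrite -lee_fin -!integral_mean//.
apply: le_integral_tails => [|x|r]; first by case: bg.
  by case/andP: (g01 x).
apply: PQ; split=> [|X Y Xr /gm XY]; last exact: lt_le_trans Xr XY.
apply: sub_sigma_algebra => X /= rX; rewrite -subr_gt0 in rX.
have [dl dl0 XP] := cg X _ rX; exists dl; split=> // Y /XP.
by rewrite ltr_norml; lra.
Qed.

Definition mean_cvg (P : nat -> probability MGHP RR) (Q : probability MGHP RR)
    (f : MGHP -> RR) : Prop :=
  forall e : RR, 0 < e -> exists N, forall n, (N <= n)%N ->
    `|\int[P n]_x f x - \int[Q]_x f x| < e.

Lemma mean_cvgE P Q f : bounded_measurable f ->
  mean_cvg P Q f <->
  (fun n => (\int[P n]_x (f x)%:E)%E) @ \oo --> (\int[Q]_x (f x)%:E)%E.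
Proof.
move=> bf; rewrite integral_mean//.
have -> : (fun n => \int[P n]_x (f x)%:E)%E = fun n => (\int[P n]_x f x)%:E.
  by apply/funext => n; rewrite integral_mean.
by split=> [h|/cvg_EFin_dist//]; apply/cvg_EFin_dist.
Qed.

(** The means of a test are squeezed between two sequences with the same limit. Convergence then
    passes to linear combinations, although these need not be monotone. *)
Lemma sandwich_span (Pm P Pp : nat -> probability MGHP RR) Q f :
  (forall n, stoch_le (Pm n) (P n) /\ stoch_le (P n) (Pp n)) ->
  weak_cvg Pm Q -> weak_cvg Pp Q -> increasing_span f -> mean_cvg P Q f.
Proof.
move=> PP cm cp; elim=> {f} [g tg|a f b g sf cf sg cg] e e0.
  have [cg g01 gm] := tg; have bg := increasing_test_bounded_measurable tg.
  have g1 : exists C : RR, forall x, `|g x| <= C by case: bg.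
  have /(mean_cvgE _ _ bg)/(_ e e0)[N NP] := cm g g1 cg.
  have /(mean_cvgE _ _ bg)/(_ e e0)[M MP] := cp g g1 cg.
  exists (maxn N M) => n; rewrite geq_max => /andP[/NP + /MP].
  have [/stoch_le_mean/(_ tg) + /stoch_le_mean/(_ tg)] := PP n.
  by rewrite !ltr_norml; lra.
have c0 : 0 < `|a| + `|b| + 1 by have := normr_ge0 a; have := normr_ge0 b; lra.
have e'0 : 0 < e / (`|a| + `|b| + 1) by rewrite divr_gt0.
have [N NP] := cf _ e'0; have [M MP] := cg _ e'0.
exists (maxn N M) => n; rewrite geq_max => /andP[/NP hf /MP hg].
have bf := increasing_span_bounded_measurable sf.
have bg := increasing_span_bounded_measurable sg.
rewrite !mean_lin//; set F := _ - _ in hf; set G := _ - _ in hg.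
rewrite (_ : _ - _ = a * F + b * G); last by rewrite /F /G; ring.
apply: le_lt_trans (ler_normD _ _) _; rewrite !normrM.
have {}e0 : e = (`|a| + `|b| + 1) * (e / (`|a| + `|b| + 1)) by field; rewrite gt_eqF.
rewrite [X in _ < X]e0 !mulrDl mul1r.
have : `|a| * `|F| <= `|a| * (e / (`|a| + `|b| + 1)) by rewrite ler_wpM2l// ltW.
have : `|b| * `|G| <= `|b| * (e / (`|a| + `|b| + 1)) by rewrite ler_wpM2l// ltW.
by lra.
Qed.

(** * Antisymmetry *)

Lemma ghp_continuous_lt (f : MGHP -> RR) r : ghp_continuous f ->
  measurable ([set X | f X < r] : set MGHP).
Proof.
move=> cf; apply: sub_sigma_algebra => X /=; rewrite -subr_gt0 => rX.
have [dl dl0 XP] := cf X _ rX; exists dl; split=> // Y /XP.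
by rewrite ltr_norml; lra.
Qed.

(** By [gap_lindelof] an open set is a countable union of sets [F k]. Each nonempty one is cut out
    by an increasing condition on [gap X Y] and the negation of an increasing condition on
    [gap Y X]. *)
Lemma increasing_generate : @measurable _ MGHP = <<s le_increasing >>.
Proof.
apply/seteqP; split; last first.
  by apply: smallest_sub => [|A []//]; exact: smallest_sigma_algebra.
apply: smallest_sub => [|U oU]; first exact: smallest_sigma_algebra.
have /choice[r rP] X : exists r : RR, 0 < r /\
    (U X -> forall Y, gap X Y < r -> gap Y X < r -> U Y).
  have [UX|nUX] := pselect (U X); last by exists 1; split.
  have [e [e0 eU]] := oU X UX; have [r r0 rP] := gap_dGHP_small X e0.
  by exists r; split=> // _ Y XY YX; apply: eU; exact: rP.
have [x xU xcov] := gap_lindelof U (fun X => (rP X).1).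
pose F k : set MGHP := if x k is Some X
  then [set Y | gap X Y < r X] `&` ~` [set Y | r X <= gap Y X] else set0.
have -> : U = \bigcup_k F k.
  apply/seteqP; split=> Y.
    move=> /xcov[k [X [xk XY YX]]]; exists k => //; rewrite /F xk.
    by split=> //=; apply/negP; rewrite -ltNge.
  move=> [k _]; rewrite /F; case E : (x k) => [X|//] [XY /negP].
  by rewrite -ltNge => YX; exact: (rP X).2 (xU _ _ E) _ XY YX.
suff mF k : measurable (F k : set (g_sigma_algebraType le_increasing)).
  exact: (@bigcup_measurable _ (g_sigma_algebraType le_increasing)).
rewrite /F; case: (x k) => [X|]; last exact: measurable0.
apply: measurableI; last apply: measurableC; apply: sub_sigma_algebra; split.
- exact: ghp_continuous_lt (@gap_continuous_r X).
- move=> Y Z /= XY /gap_mm_le YZ.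
  by have := gap_tri Y X Z; rewrite YZ; lra.
- rewrite (_ : [set Y | _] = ~` [set Y | gap Y X < r X]).
    by apply: measurableC; exact: ghp_continuous_lt (@gap_continuous_l X).
  by apply/seteqP; split=> Y /=; rewrite leNgt => /negP.
- move=> Y Z /= YX /gap_mm_le YZ.
  by have := gap_tri Z Y X; rewrite YZ; lra.
Qed.

Lemma stoch_le_antisym (P Q : probability MGHP RR) :
  stoch_le P Q -> stoch_le Q P -> forall A : set MGHP, measurable A -> P A = Q A.
Proof.
move=> PQ QP; apply: (measure_unique le_increasing (fun=> setT)).
- exact: increasing_generate.
- move=> A B [mA iA] [mB iB]; split; first exact: measurableI.
  by move=> X Y [AX BX] XY; split; [exact: iA AX XY|exact: iB BX XY].
- by move=> _; split=> //; exact: measurableT.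
- by rewrite bigcup_const//; exists 0%N.
- by move=> A iA; apply/eqP; rewrite eq_le PQ// QP.
- by move=> _; apply: le_lt_trans (probability_le1 P measurableT) _; rewrite ltry.
Qed.

(** * Partition of unity in the increasing span, and the sandwich theorem *)

Section bumps.
Variables (f : MGHP -> RR) (e : RR) (r : mmspace -> RR) (x : nat -> option mmspace).
Hypothesis r0 : forall X, 0 < r X.
Hypothesis osc : forall X Y, gap X Y < 2 * r X -> gap Y X < 2 * r X ->
  `|f X - f Y| < e.

(** Equal to [1] when both gaps are at most [r X], and to [0] once either reaches [2 * r X]. *)
Definition bump (k : nat) (Y : MGHP) : RR := if x k is Some X
  then clamp (2 - (r X)^-1 * gap X Y) * clamp (2 - (r X)^-1 * gap Y X) else 0.

Definition center k : RR := if x k is Some X then f X else 0.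

Definition rest N (Y : MGHP) : RR := \prod_(k < N) (1 - bump k Y).

(** The weights [bump k Y * rest k Y] telescope: for [k < N] they add up to [1 - rest N Y]. *)
Definition approx N (Y : MGHP) : RR := \sum_(k < N) center k * bump k Y * rest k Y.

Lemma bump01 k Y : 0 <= bump k Y <= 1.
Proof.
rewrite /bump; case: (x k) => [X|]; last by rewrite lexx ler01.
have /andP[a0 a1] := clamp01 (2 - (r X)^-1 * gap X Y).
have /andP[b0 b1] := clamp01 (2 - (r X)^-1 * gap Y X).
by rewrite mulr_ge0//= mulr_ile1.
Qed.

Lemma bump_osc k Y : bump k Y * `|f Y - center k| <= bump k Y * e.
Proof.
rewrite /bump /center; case: (x k) => [X|]; last by rewrite !mul0r.
have far t : 2 * r X <= t -> clamp (2 - (r X)^-1 * t) = 0.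
  by move=> h; apply: clamp_le0; rewrite subr_le0 ler_pdivlMl// mulrC.
have [XY|/far->] := ltP (gap X Y) (2 * r X); last by rewrite !mul0r.
have [YX|/far->] := ltP (gap Y X) (2 * r X); last by rewrite mulr0 !mul0r.
apply: ler_wpM2l; last by rewrite distrC ltW// osc.
by apply: mulr_ge0; [case/andP: (clamp01 (2 - (r X)^-1 * gap X Y))
  |case/andP: (clamp01 (2 - (r X)^-1 * gap Y X))].
Qed.

Lemma rest01 N Y : 0 <= rest N Y <= 1.
Proof.
have b k := bump01 k Y; rewrite /rest; elim: N => [|N IH].
  by rewrite big_ord0 ler01 lexx.
rewrite big_ord_recr /=; have /andP[? ?] := IH; have /andP[? ?] := b N.
by rewrite mulr_ge0 ?mulr_ile1//; lra.
Qed.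

(** Each weight lives where [f] differs from its center value by less than [e], and the weights sum
    to [1 - rest N Y]. *)
Lemma approx_dist N Y :
  `|f Y * (1 - rest N Y) - approx N Y| <= e * (1 - rest N Y).
Proof.
elim: N => [|N IH].
  by rewrite /rest /approx !big_ord0 subrr !mulr0 subrr normr0.
have E1 : rest N.+1 Y = rest N Y * (1 - bump N Y) by rewrite /rest big_ord_recr.
have E2 : approx N.+1 Y = approx N Y + center N * bump N Y * rest N Y.
  by rewrite /approx big_ord_recr.
rewrite E1 E2 (_ : _ - _ = (f Y * (1 - rest N Y) - approx N Y) +
  (bump N Y * (f Y - center N)) * rest N Y); last by ring.
apply: le_trans (ler_normD _ _) _.
rewrite (_ : e * _ = e * (1 - rest N Y) + bump N Y * e * rest N Y); last by ring.
have /andP[? ?] := rest01 N Y; have /andP[? ?] := bump01 N Y.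
rewrite lerD// normrM (ger0_norm (x := rest N Y))// ler_wpM2r//.
by rewrite normrM ger0_norm// bump_osc.
Qed.

Lemma increasing_span_bump k : increasing_span (bump k).
Proof.
have s1 := span_test increasing_test1.
rewrite /bump; case: (x k) => [X|]; last first.
  by apply: span_test; apply: increasing_test_cst; rewrite lexx ler01.
have su := span_test (increasing_test_gap_r X (r0 X)).
have sv := span_test (increasing_test_gap_l X (r0 X)).
have := increasing_spanM su (span_lin 1 (-1) s1 sv); congr increasing_span.
by apply/funext => Y; rewrite clamp_opp; ring.
Qed.

Lemma increasing_span_rest N : increasing_span (rest N).
Proof.
have s1 := span_test increasing_test1.
elim: N => [|N IH].
  by move: s1; congr increasing_span; apply/funext => Y; rewrite /rest big_ord0.
have := increasing_spanM IH (span_lin 1 (-1) s1 (increasing_span_bump N)).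
congr increasing_span; apply/funext => Y; rewrite /rest big_ord_recr /=.
by ring.
Qed.

Lemma increasing_span_approx N : increasing_span (approx N).
Proof.
elim: N => [|N IH].
  have := span_test (@increasing_test_cst 0 _); rewrite lexx ler01 => /(_ isT).
  by congr increasing_span; apply/funext => Y; rewrite /approx big_ord0.
have := span_lin 1 (center N) IH
  (increasing_spanM (increasing_span_bump N) (increasing_span_rest N)).
congr increasing_span; apply/funext => Y; rewrite /approx big_ord_recr /=.
by ring.
Qed.

(** A bump equal to [1] at [Y] puts a zero factor into every later product. *)
Lemma rest_eq0 Y : (exists k X, [/\ x k = Some X, gap X Y < r X & gap Y X < r X]) ->
  exists N, forall n, (N <= n)%N -> rest n Y = 0.
Proof.
move=> [k [X [xk XY YX]]]; exists k.+1 => n kn.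
have near t : t < r X -> clamp (2 - (r X)^-1 * t) = 1.
  move=> tr; apply: clamp_ge1; have : (r X)^-1 * t <= 1.
    by rewrite ler_pdivrMl// mulr1 ltW.
  by lra.
rewrite /rest (bigD1 (Ordinal kn))//= /bump xk !near// mulr1 subrr mul0r.
by [].
Qed.

End bumps.

Lemma weak_cvg_sandwich (Pm P Pp : nat -> probability MGHP RR)
    (Q : probability MGHP RR) :
  (forall n, stoch_le (Pm n) (P n) /\ stoch_le (P n) (Pp n)) ->
  weak_cvg Pm Q -> weak_cvg Pp Q -> weak_cvg P Q.
Proof.
move=> PP cm cp f [C fC] cf.
have bf : bounded_measurable f.
  by split; [exact: ghp_continuous_measurable|exists C].
have C0 : 0 <= C by apply: le_trans (fC unit_mm); exact: normr_ge0.
(* Replacing [f] by [approx] costs [3 * e] under [P n] and [2 * e] under [Q], and the means of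
   [approx] differ by [e]: in all [6 * e], below [t]. *)
apply/mean_cvgE => // t t0; pose e := t / 8; have e0 : 0 < e by rewrite /e; lra.
have /choice[r rP] X : exists r : RR, 0 < r /\ forall Y,
    gap X Y < 2 * r -> gap Y X < 2 * r -> `|f X - f Y| < e.
  have [dl dl0 fX] := cf X _ e0; have [r r0 rP] := gap_dGHP_small X dl0.
  exists (r / 2); split=> [|Y]; first by lra.
  by rewrite mulrC divfK// => XY YX; apply: fX; exact: rP.
have r0 X := (rP X).1; have osc X := (rP X).2.
have [x _ xcov] := gap_lindelof setT r0.
have srest N := increasing_span_rest x r0 N.
have sapp N := increasing_span_approx f x r0 N.
have brest N := increasing_span_bounded_measurable (srest N).
have bapp N := increasing_span_bounded_measurable (sapp N).
have dist (S : probability MGHP RR) N :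
    `|\int[S]_y f y - \int[S]_y approx f r x N y| <= C * \int[S]_y rest r x N y + e.
  have pt y : `|f y - approx f r x N y| <= C * rest r x N y + e.
    have := approx_dist x r0 osc N y; have := rest01 r x N y; have := fC y.
    set a := approx _ _ _ _ _; set b := rest _ _ _ _ => fy /andP[b0 b1] d1.
    (* The first term is the part of [f] not yet covered by bumps; [approx_dist] bounds the
       second. *)
    rewrite (_ : f y - a = f y * b + (f y * (1 - b) - a)); last by ring.
    apply: le_trans (ler_normD _ _) _; rewrite normrM (ger0_norm (x := b))//.
    apply: lerD; first by rewrite ler_wpM2r.
    by apply: le_trans d1 _; rewrite ler_piMr ?(ltW e0)//; lra.
  have b1 : bounded_measurable (cst 1 : MGHP -> RR).
    exact: increasing_test_bounded_measurable increasing_test1.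
  have bsum c := bounded_measurable_lin 1 c (bapp N) (brest N).
  have b1sum c c' := bounded_measurable_lin 1 c' (bsum c) b1.
  have lo := le_mean S (b1sum (- C) (- e)) bf
    ltac:(by move=> y; have := pt y; rewrite ler_norml /=; lra).
  have up := le_mean S bf (b1sum C e)
    ltac:(by move=> y; have := pt y; rewrite ler_norml /=; lra).
  move: lo up; rewrite !mean_lin// mean_cst ler_norml.
  by lra.
have d0 : 0 < e / (C + 1) by rewrite divr_gt0//; lra.
(* [N] is chosen for the limit [Q] alone. Since [rest] lies in the span, its mean under [P n] is
   also small for large [n], which takes the place of tightness. *)
have [N NQ] : exists N, \int[Q]_y rest r x N y < e / (C + 1).
  apply: mean_cvg0 => //.
  - by move=> n; case: (brest n).
  - by move=> n y; exact: rest01.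
  - by move=> y; apply: rest_eq0 => //; exact: xcov.
have [M1 M1P] := sandwich_span PP cm cp (srest N) d0.
have [M2 M2P] := sandwich_span PP cm cp (sapp N) e0.
exists (maxn M1 M2) => n; rewrite geq_max => /andP[/M1P h1 /M2P h2].
have Cd : C * (e / (C + 1)) <= e.
  by rewrite mulrCA ler_piMr ?(ltW e0)// ler_pdivrMr; lra.
have hQ : C * \int[Q]_y rest r x N y <= e.
  by apply: le_trans Cd; rewrite ler_wpM2l// ltW.
have hP : C * \int[P n]_y rest r x N y <= 2 * e.
  have : C * \int[P n]_y rest r x N y <= C * (2 * (e / (C + 1))).
    by rewrite ler_wpM2l//; move: h1; rewrite ltr_norml; lra.
  by lra.
have := dist (P n) N; have := dist Q N; move: h2.
rewrite /e in hP hQ *.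
rewrite !ltr_norml !ler_norml; lra.
Qed.

Theorem theorem1p3 :
  (* stoch_le is a partial order on M_1(M_GHP) *)
  (forall P : probability MGHP RR, stoch_le P P) /\
  (forall P Q S : probability MGHP RR,
      stoch_le P Q -> stoch_le Q S -> stoch_le P S) /\
  (forall P Q : probability MGHP RR, stoch_le P Q -> stoch_le Q P ->
      forall A : set MGHP, measurable A -> P A = Q A) /\
  (* sandwich theorem *)
  (forall (Pm P Pp : nat -> probability MGHP RR) (Pinf : probability MGHP RR),
      (forall n, stoch_le (Pm n) (P n) /\ stoch_le (P n) (Pp n)) ->
      weak_cvg Pm Pinf -> weak_cvg Pp Pinf -> weak_cvg P Pinf).
Proof.
split; first by move=> P A.
split; first by move=> P Q S PQ QS A iA; exact: le_trans (PQ A iA) (QS A iA).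
by split; [exact: stoch_le_antisym | exact: weak_cvg_sandwich].
Qed.
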